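(* Let $0<\epsilon\le\frac17$ and $3<\alpha<4$, and suppose $\frac{k^2d^2}{n}\le\epsilon$ and $\frac{k^4n^{\alpha-2}}{d^{\alpha}}\le\epsilon^2$. Let $H$ be an arbitrary balanced graph on $k$ vertices with average degree $\alpha$, and let $G\sim G_{n,d}$. Then with probability at least $1-4\epsilon$ (over the choice of $G$), $G$ contains a set $S$ of $k$ vertices such that (1) the subgraph of $G$ induced on $S$ is isomorphic to $H$, and (2) no two vertices of $S$ have a common neighbor outside $S$.
   Context: A graph is balanced if every induced subgraph has average degree at most the average degree of the graph. $G_{n,d}$ is the random graph on $n$ vertices in which each edge is present independently with probability $p=\frac{d}{n-1}$. *)

(* Defs.v *)
From HB Require Import structures.
From mathcomp Require Import all_boot all_order all_algebra.
From mathcomp Require Import boolp reals exp.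

Set Implicit Arguments.
Unset Strict Implicit.
Unset Printing Implicit Defensive.

Import Order.TTheory GRing.Theory Num.Theory.

Local Open Scope ring_scope.

(* MathComp / MathComp-Analysis. A graph is its set of edges, an edge being a
   two-element set of vertices, so graphs are simple by construction. *)
Record sgraph (V : finType) := SGraph {
  edges : {set {set V}};
  edges_card2 : [forall e in edges, #|e| == 2]
}.

HB.instance Definition _ (V : finType) := [isSub for @edges V].
HB.instance Definition _ (V : finType) := [Finite of sgraph V by <:].

Definition adj (V : finType) (G : sgraph V) : rel V :=
  fun x y => [set x; y] \in edges G.

Definition degree (V : finType) (G : sgraph V) (x : V) : nat :=
  #|[set y | adj G x y]|.

Definition avg_degree (V : finType) (G : sgraph V) : rat :=
  (\sum_(x : V) degree G x)%N%:R / #|V|%:R.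

Section Induced.
Variables (V : finType) (G : sgraph V) (S : {set V}).

Definition induced_edges : {set {set {x : V | x \in S}}} :=
  [set e : {set {x : V | x \in S}} | val @: e \in edges G].

Lemma induced_edges_card2 : [forall e in induced_edges, #|e| == 2].
Proof.
apply/forall_inP => e; rewrite inE => eG.
by rewrite -(card_imset _ val_inj) (forall_inP (edges_card2 G)).
Qed.

Definition induced : sgraph {x : V | x \in S} := SGraph induced_edges_card2.

End Induced.

Definition isomorphic (V W : finType) (G : sgraph V) (H : sgraph W) : Prop :=
  exists2 f : V -> W, bijective f & forall x y, adj G x y = adj H (f x) (f y).

Definition balanced (V : finType) (G : sgraph V) : Prop :=
  forall S : {set V}, S != set0 -> avg_degree (induced G S) <= avg_degree G.

Definition common_neighbor (V : finType) (G : sgraph V) (u v w : V) : bool :=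
  adj G u w && adj G v w.

Definition no_common_neighbor_outside (V : finType) (G : sgraph V)
    (S : {set V}) : Prop :=
  forall u v w : V, u \in S -> v \in S -> u != v -> w \notin S ->
    ~~ common_neighbor G u v w.

Definition vpairs (V : finType) : {set {set V}} := [set e : {set V} | #|e| == 2].

(* Probability mass of G when the pairs of vertices are edges independently,
   each with probability p; a probability distribution when 0 <= p <= 1. *)
Definition gnp_mass (R : realType) (V : finType) (p : R) (G : sgraph V) : R :=
  \prod_(e in vpairs V) (if e \in edges G then p else 1 - p).

Definition gnp_prob (R : realType) (V : finType) (p : R)
    (A : sgraph V -> Prop) : R :=
  \sum_(G : sgraph V | `[< A G >]) gnp_mass p G.

(* G_{n,d}: the edge probability d / (n - 1) makes d the expected degree. *)
Definition gnd_prob (R : realType) (n : nat) (d : R)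
    (A : sgraph 'I_n -> Prop) : R :=
  gnp_prob (d / (n%:R - 1)) A.

Lemma gnp_prob_total (R : realType) (V : finType) (p : R) :
  gnp_prob p (fun _ : sgraph V => True) = 1.
Proof.
rewrite /gnp_prob.
have -> : 1 = \prod_(e : {set V}) ((if e \in vpairs V then p else 0) +
                                  (if e \in vpairs V then 1 - p else 1)).
  by rewrite big1 // => e _; case: ifP => _; rewrite ?add0r // addrC subrK.
rewrite bigA_distr (bigID (fun D : {set {set V}} => D \subset vpairs V)) /=.
rewrite [X in _ + X]big1 ?addr0 => [|D /subsetPn[e eD eV]]; last first.
  by rewrite (bigD1 e) //= eD (negbTE eV) mul0r.
have subE (D : {set {set V}}) :
    [forall e in D, #|e| == 2] = (D \subset vpairs V).
  by apply/forall_inP/subsetP => DV e /DV; rewrite inE.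
rewrite (reindex_omap (@edges V) insub) => [|D DV].
  apply: eq_big => [G|G _].
    by rewrite asboolT // -subE edges_card2 /= (valK G) eqxx.
  rewrite /gnp_mass big_mkcond; apply: eq_bigr => e _ /=.
  have := subsetP (etrans (esym (subE _)) (edges_card2 G)) e.
  by case: (e \in edges G) => [/(_ isT) ->|_] //; case: ifP.
by rewrite insubT ?subE.
Qed.

(* Main.v *)
(** Let [X] count the permutations [s] of the vertices for which [s \o f], with
    [f] a fixed embedding of the [k] vertices of [H], is a copy of [H] with the
    two required properties.  Given that the [m] edges of the copy are present,
    it fails to be induced, or two of its vertices have a common neighbour
    outside, with probability at most [k^2 p + k^2 n p^2], by a union bound.
    For the second moment only the edges of the copies matter: as [H] is
    balanced, two copies sharing [i] vertices share at most [alpha i / 2] edges,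
    so that [E[X^2] <= (n! p^m)^2 E[a^i]] with [a = p^(- alpha / 2)] and [i] the
    size of the intersection of a random [k]-set with a fixed one; this last
    expectation is at most [(1 + (a - 1) k / n)^k], where [a k^2 / n <= eps].
    The indicator of [X != 0] is at least [2 c X - c^2 X^2], and the choice
    [c = (1 - eps) / (n! p^m)] concludes. *)
Require Import Defs.
From mathcomp Require Import all_boot all_order all_algebra all_fingroup.
From mathcomp Require Import boolp reals sequences exp.
From mathcomp Require Import ring lra zify.

Import Order.TTheory GRing.Theory Num.Theory.

Local Open Scope ring_scope.

(** * Forced edges in the random graph and the second moment inequality *)

Lemma gnp_mass_ge0 (R : realType) (V : finType) (p : R) (G : sgraph V) :
  0 <= p <= 1 -> 0 <= gnp_mass p G.
Proof.
move=> /andP[p0 p1]; apply: prodr_ge0 => e _.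
by case: ifP; rewrite ?subr_ge0.
Qed.

(** The sum over edge sets containing [A] is the expansion of a product with factor [p] for each [e]
    in [A] and 1 otherwise. *)
Lemma gnp_mass_superset (R : realType) (V : finType) (p : R)
    (A : {set {set V}}) :
  A \subset vpairs V ->
  \sum_(G : sgraph V) gnp_mass p G * (A \subset edges G)%:R = p ^+ #|A|.
Proof.
move=> AV.
(* [f] and [g] weigh presence and absence of [e]: [g] vanishes on [A], so edge sets missing part of
   [A] contribute 0, and a set that is not a pair is always absent. *)
pose f e : R := if e \in vpairs V then p else 0.
pose g e : R := if e \in A then 0 else if e \in vpairs V then 1 - p else 1.
have -> : p ^+ #|A| = \prod_(e : {set V}) (f e + g e).
  rewrite -prodr_const [LHS]big_mkcond; apply: eq_bigr => e _; rewrite /f /g.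
  have := subsetP AV e; case: (e \in A) => [->//|_]; first by rewrite addr0.
  by case: ifP => _; rewrite ?add0r // addrC subrK.
rewrite bigA_distr (bigID (fun D : {set {set V}} => D \subset vpairs V)) /=.
rewrite [X in _ + X]big1 ?addr0 => [|D /subsetPn[e eD eV]]; last first.
  by rewrite (bigD1 e) //= eD /f (negbTE eV) mul0r.
have subE (D : {set {set V}}) :
    [forall e in D, #|e| == 2] = (D \subset vpairs V).
  by apply/forall_inP/subsetP => DV e /DV; rewrite inE.
rewrite (reindex_omap (@edges V) insub) => [|D DV]; last first.
  by rewrite insubT ?subE.
apply: eq_big => [G|G _].
  by rewrite -subE edges_card2 /= (valK G) eqxx.
have GV : edges G \subset vpairs V by rewrite -subE edges_card2.
have [AG|/subsetPn[e eA eG]] := boolP (A \subset edges G); last first.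
  by rewrite mulr0 (bigD1 e) //= (negbTE eG) /g eA mul0r.
rewrite mulr1 /gnp_mass big_mkcond; apply: eq_bigr => e _ /=.
have := subsetP GV e; have := subsetP AG e; rewrite /f /g.
case: (e \in edges G) => [_ /(_ isT) ->//|].
by case: (e \in A) => [/(_ isT)|_ _] //; case: ifP.
Qed.

(** Where [X] is nonzero this is [(1 - c X)^2 >= 0]; elsewhere both sides vanish. *)
Lemma second_moment_method (R : realType) (T : finType) (w X : T -> R) (c : R) :
  (forall t, 0 <= w t) ->
  2 * c * (\sum_t w t * X t) - c ^+ 2 * (\sum_t w t * X t ^+ 2) <=
    \sum_(t | X t != 0) w t.
Proof.
move=> w0; rewrite !mulr_sumr -sumrB [leRHS]big_mkcond /=.
apply: ler_sum => t _; case: eqP => [->|_] /=.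
  by rewrite expr0n /= !mulr0 subr0.
have := mulr_ge0 (w0 t) (sqr_ge0 (1 - c * X t)); lra.
Qed.

(** * Random permutations and overlaps of fixed sets *)

(* Exchanging [x] with any [y] outside [T] shows that the left-hand count does
   not depend on [x]; sum it over all such [y]. *)
Lemma perm_mem_count (n : nat) (F T : {set 'I_n}) (x : 'I_n) :
  x \notin T ->
  ((n - #|T|) * #|[set s : 'S_n | x |: T \subset s @^-1: F]| =
   (#|F| - #|T|) * #|[set s : 'S_n | T \subset s @^-1: F]|)%N.
Proof.
move=> xT.
have swap y : y \notin T ->
    #|[set s : 'S_n | y |: T \subset s @^-1: F]| =
    #|[set s : 'S_n | x |: T \subset s @^-1: F]|.
  move=> yT; rewrite -(card_imset _ (mulgI (tperm x y))).
  have fixT (r : 'S_n) :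
      (T \subset (tperm x y * r)%g @^-1: F) = (T \subset r @^-1: F).
    have fixz z : z \in T -> tperm x y z = z.
      move=> zT; rewrite tpermD //;
        by [apply: contraNneq xT => -> | apply: contraNneq yT => ->].
    by apply/subsetP/subsetP => rT z zT; move: (rT z zT); rewrite !inE permM fixz.
  apply: eq_card => s; apply/imsetP/idP => [[r + ->]|].
    by rewrite !inE !subUset !sub1set fixT !inE permM tpermL.
  move=> sT; exists (tperm x y * s)%g; last by rewrite mulgA tperm2 mul1g.
  by move: sT; rewrite !inE !subUset !sub1set fixT !inE permM tpermR.
have -> : (n - #|T| = #|~: T|)%N by rewrite [RHS]cardsCs setCK card_ord.
rewrite -sum_nat_const.
rewrite (eq_bigr (fun y =>
  \sum_(s : 'S_n | T \subset s @^-1: F) (s y \in F : nat))%N); last first.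
  move=> y; rewrite inE => yT; rewrite -(swap y) // -sum1_card.
  rewrite big_mkcond [RHS]big_mkcond; apply: eq_bigr => s _ /=.
  by rewrite inE subUset sub1set inE; case: (s y \in F); case: (T \subset _).
(* A fixed [s] mapping [T] into [F] is now counted once for each [y] outside [T] with [s y] in
   [F]. *)
rewrite exchange_big /= mulnC -sum_nat_const.
rewrite [RHS](eq_bigl (fun s : 'S_n => T \subset s @^-1: F)) => [|s];
  last by rewrite inE.
apply: eq_bigr => s TF.
transitivity #|(s @^-1: F) :\: T|; last first.
  by rewrite cardsD (setIidPr TF) card_preimset //; exact: perm_inj.
rewrite -sum1_card [LHS]big_mkcond [RHS]big_mkcond.
by apply: eq_bigr => y _; rewrite !inE; case: (y \in T); case: (s y \in F).
Qed.

(** Removing the points of [T] one by one gives factors [(#|F| - t) / (n - t)], each at most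
    [#|F| / n] because [#|F| <= n]. *)
Lemma perm_mem_count_le (R : realType) (n : nat) (F T : {set 'I_n}) :
  #|[set s : 'S_n | T \subset s @^-1: F]|%:R <=
    n`!%:R * (#|F|%:R / n%:R) ^+ #|T| :> R.
Proof.
have [m Tm] := ubnP #|T|; elim: m => // m IH in T Tm *.
have [->|/set0Pn[x xT]] := eqVneq T set0.
  rewrite cards0 expr0 mulr1 (eq_card (B := 'S_n)) ?card_Sn // => s.
  by rewrite inE sub0set.
have xT' : x \notin T :\ x by rewrite !inE eqxx.
have cT : #|T| = #|T :\ x|.+1 by rewrite (cardsD1 x) xT.
move: Tm (perm_mem_count n F (T :\ x) x xT'); rewrite setD1K // cT ltnS.
move=> /IH {}IH.
set N' := #|[set s : 'S_n | T :\ x \subset _]| in IH *.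
set N := #|[set s : 'S_n | _]|; set t := #|T :\ x| in IH cT *; move=> NN'.
have tn : (t < n)%N by rewrite -cT -[n in (_ <= n)%N]card_ord max_card.
have Fn : (#|F| <= n)%N by rewrite -[n in (_ <= n)%N]card_ord max_card.
have n0 : (0 < n)%N by case: (n) tn.
rewrite exprSr mulrA; apply: le_trans (ler_wpM2r _ IH); last by rewrite divr_ge0.
rewrite mulrA ler_pdivlMr ?ltr0n // -!natrM ler_nat.
rewrite -(@leq_pmul2l (n - t)) ?subn_gt0 // mulnA NN' [leqRHS]mulnA.
rewrite mulnAC [leqRHS]mulnAC leq_mul2r; apply/orP; right.
by rewrite mulnBl mulnBl mulnC; nia.
Qed.

Lemma prodr_1D_set (R : realType) (I : finType) (T : {set I}) (g : I -> R) :
  \prod_(i in T) (1 + g i) = \sum_(J : {set I} | J \subset T) \prod_(i in J) g i.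
Proof.
transitivity (\prod_i ((if i \in T then g i else 0) + 1)).
  by rewrite big_mkcond; apply: eq_bigr => i _; case: ifP; rewrite ?add0r // addrC.
rewrite bigA_distr (bigID (fun J : {set I} => J \subset T)) /=.
rewrite [X in _ + X]big1 ?addr0 => [|J /subsetPn[i iJ iT]]; last first.
  by rewrite (bigD1 i) //= iJ (negbTE iT) mul0r.
apply: eq_bigr => J JT; rewrite [RHS]big_mkcond; apply: eq_bigr => i _.
by case: ifP => // /(subsetP JT) ->.
Qed.

(* A hypergeometric generating function is dominated by a binomial one. *)
Lemma sum_perm_prod_le (R : realType) (n : nat) (b : R) (F T : {set 'I_n}) :
  0 <= b ->
  \sum_(s : 'S_n) \prod_(x in T) (1 + b * (s x \in F)%:R) <=
    n`!%:R * (1 + b * (#|F|%:R / n%:R)) ^+ #|T|.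
Proof.
move=> b0; under eq_bigr do rewrite prodr_1D_set.
(* Both sides become sums over the subsets [J] of [T], compared term by term. *)
rewrite exchange_big -prodr_const prodr_1D_set mulr_sumr /=.
apply: ler_sum => J _.
rewrite prodr_const exprMn mulrCA.
apply: le_trans (ler_wpM2l _ (perm_mem_count_le R n F J)); last exact: exprn_ge0.
have -> : #|[set s : 'S_n | J \subset s @^-1: F]|%:R =
    \sum_(s : 'S_n) (J \subset s @^-1: F)%:R :> R.
  rewrite -sum1_card natr_sum big_mkcond; apply: eq_bigr => s _.
  by rewrite inE; case: (J \subset _).
rewrite mulr_sumr; apply: ler_sum => s _.
rewrite big_split prodr_const /=.
have [JF|/subsetPn[x xJ]] := boolP (J \subset _); last first.
  by rewrite inE => /negbTE sF; rewrite (bigD1 x) //= sF mul0r !mulr0.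
by rewrite big1 ?mulr1 // => x /(subsetP JF); rewrite inE => ->.
Qed.

(** * Edge counts and balanced graphs *)

Lemma edge_card (V : finType) (G : sgraph V) (e : {set V}) :
  e \in edges G -> #|e| = 2.
Proof. by move=> eG; apply/eqP/(forall_inP (edges_card2 G)). Qed.

Lemma adj_neq (V : finType) (G : sgraph V) (x y : V) : adj G x y -> x != y.
Proof. by move=> /edge_card; rewrite cards2; case: eqP. Qed.

Lemma degree_edges (V : finType) (G : sgraph V) (x : V) :
  degree G x = #|[set e in edges G | x \in e]|.
Proof.
rewrite /degree -(card_in_imset (f := fun y => [set x; y])).
  apply: eq_card => e; apply/imsetP/idP => [[y + ->]|].
    by rewrite !inE eqxx andbT.
  rewrite inE => /andP[eG xe]; have /eqP := edge_card _ _ _ eG.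
  rewrite (cardsD1 x) xe eqSS => /cards1P[y ey].
  have E : e = [set x; y] by rewrite -(setD1K xe) ey.
  by exists y; rewrite ?inE // /adj -E.
move=> y z; rewrite !inE => xy xz /setP/(_ y).
by rewrite !inE eqxx orbT eq_sym (negbTE (adj_neq _ _ _ _ xy)) => /esym/eqP.
Qed.

Lemma handshake (V : finType) (G : sgraph V) :
  (\sum_x degree G x = #|edges G| * 2)%N.
Proof.
under eq_bigr do rewrite degree_edges -sum1dep_card big_mkcondr.
rewrite exchange_big -sum_nat_const; apply: eq_bigr => e eG /=.
by rewrite -big_mkcond sum1_card (edge_card _ _ _ eG).
Qed.

(** By the handshake identity, the average degree of the subgraph induced on [S] is twice its number
    of edges over [#|S|]; the empty [S], not covered by [balanced], is trivial. *)
Lemma balanced_edges (R : realType) (V : finType) (H : sgraph V) (S : {set V}) :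
  balanced H ->
  2 * #|[set e in edges H | e \subset S]|%:R <= ratr (avg_degree H) * #|S|%:R :> R.
Proof.
move=> balH; have [->|S0] := eqVneq S set0.
  rewrite cards0 mulr0 (eq_card0 (A := mem [set _ in _ | _])) ?mulr0 // => e.
  rewrite !inE subset0; apply/negP => /andP[/edge_card + /eqP e0].
  by rewrite e0 cards0.
have -> : #|[set e in edges H | e \subset S]| = #|edges (induced H S)|.
  rewrite -(card_imset (edges _)
    (imset_inj (val_inj (T := V) (sT := {x : V | x \in S})))).
  apply: eq_card => e; apply/idP/imsetP => [|[e' + ->]].
    rewrite inE => /andP[eH /subsetP eS].
    have E : e = val @: [set z : {x | x \in S} | val z \in e].
      apply/setP => x; apply/idP/imsetP => [xe|[z + ->]]; last by rewrite inE.
      by exists (Sub x (eS x xe)); rewrite ?inE !SubK.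
    by exists [set z : {x | x \in S} | val z \in e]; rewrite // inE -E.
  rewrite !inE => ->; apply/subsetP => x /imsetP[z _ ->]; exact: valP.
have S1 : 0 < #|S|%:R :> R by rewrite ltr0n card_gt0.
rewrite -ler_pdivrMr // mulrC.
have := balH S S0; rewrite -(ler_rat R) /avg_degree !handshake card_sig.
rewrite fmorph_div /= !ratr_nat natrM.
by apply: le_trans; rewrite mulrC [2 * _]mulrC.
Qed.

(** * Copies of [H] and their common edges *)

Definition image_edges {V W : finType} (f : V -> W) (H : sgraph V) :
  {set {set W}} := [set f @: e | e : {set V} in edges H].

Lemma image_edges_vpairs (V W : finType) (f : V -> W) (H : sgraph V) :
  injective f -> image_edges f H \subset vpairs W.
Proof.
move=> fI; apply/subsetP => _ /imsetP[e eH ->].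
by rewrite inE card_imset // (edge_card _ _ _ eH).
Qed.

Lemma card_image_edges (V W : finType) (f : V -> W) (H : sgraph V) :
  injective f -> #|image_edges f H| = #|edges H|.
Proof. by move=> fI; rewrite card_imset //; exact: imset_inj. Qed.

Lemma mem_image_edges (V W : finType) (f : V -> W) (H : sgraph V) (x y : V) :
  injective f -> ([set f x; f y] \in image_edges f H) = adj H x y.
Proof.
move=> fI; have <- : f @: [set x; y] = [set f x; f y].
  by rewrite imsetU1 imset_set1.
by rewrite mem_imset //; exact: imset_inj.
Qed.

(** A common edge is the image under [g] of an edge of [H] inside [U], the vertices that [g] sends
    into the first copy, and balancedness bounds the edges inside [U]. *)
Lemma card_common_edges (R : realType) (V W : finType) (f g : V -> W)
    (H : sgraph V) :
  balanced H -> injective g ->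
  2 * #|image_edges f H :&: image_edges g H|%:R <=
    ratr (avg_degree H) * #|[set x | g x \in f @: V]|%:R :> R.
Proof.
move=> balH gI; set U := [set x | _].
apply: le_trans (balanced_edges R V H U balH).
rewrite ler_pM2l ?ltr0n // ler_nat.
rewrite -(card_imset (mem [set e in edges H | e \subset U]) (imset_inj gI)).
apply/subset_leq_card/subsetP => _ /setIP[/imsetP[e eH ->] /imsetP[e' e'H fe]].
rewrite fe imset_f // inE e'H; apply/subsetP => x xe'.
have : g x \in f @: e by rewrite fe imset_f.
by rewrite inE; apply/subsetP/imsetS/subsetP.
Qed.

(** * Nice copies and the first moment *)

(** Attached to a map rather than to a vertex set, so that copies can be indexed by permutations. *)
Definition nice_copy {V W : finType} (H : sgraph V) (G : sgraph W)
    (f : V -> W) : bool :=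
  [forall x, forall y, adj H x y == adj G (f x) (f y)] &&
  [forall x, forall y, forall w, (x != y) ==> (w \notin f @: V) ==>
     ~~ common_neighbor G (f x) (f y) w].

Lemma nice_copyP (V W : finType) (H : sgraph V) (G : sgraph W) (f : V -> W) :
  injective f -> nice_copy H G f ->
  [/\ #|f @: V| = #|V|, isomorphic (induced G (f @: V)) H &
      no_common_neighbor_outside G (f @: V)].
Proof.
move=> fI /andP[/'forall_forallP fadj /'forall_forallP fcn].
split; first by rewrite card_imset.
- pose h (x : V) : {w | w \in f @: V} := exist _ (f x) (imset_f f (isT : x \in V)).
  have hI : injective h by move=> x y /(congr1 val) /fI.
  have [|g hK gK] := inj_card_bij hI; first by rewrite card_sig card_imset.
  exists g => [|a b]; first by exists h.
  rewrite -{1}(gK a) -{1}(gK b) (eqP (fadj _ _)).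
  by rewrite /adj inE imsetU1 imset_set1.
- move=> _ _ w /imsetP[x _ ->] /imsetP[y _ ->] xy wf.
  move/forallP: (fcn x y) => /(_ w); rewrite wf /= => /implyP; apply.
  by apply: contraNneq xy => ->.
Qed.

(** A union bound for each fixed [G]. Each bad event is written as the presence of [E] and one or
    two further pairs, so that its probability is a power of [p]. *)
Lemma nice_copy_ge (R : realType) (V W : finType) (H : sgraph V) (G : sgraph W)
    (f : V -> W) (E := image_edges f H) :
  injective f ->
  (E \subset edges G)%:R
    - \sum_x \sum_(y | (x != y) && ~~ adj H x y)
        ([set f x; f y] |: E \subset edges G)%:R
    - \sum_x \sum_(y | x != y) \sum_(w | w \notin f @: V)
        ([set f x; w] |: ([set f y; w] |: E) \subset edges G)%:R
  <= (nice_copy H G f)%:R :> R.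
Proof.
move=> fI.
set S1 := (X in _ - X - _); set S2 := (X in _ - _ - X).
have S1_ge0 : 0 <= S1 by do 2!apply: sumr_ge0 => ? _; rewrite ler0n.
have S2_ge0 : 0 <= S2 by do 3!apply: sumr_ge0 => ? _; rewrite ler0n.
have [EG|] := boolP (E \subset _); last first.
  by move=> _; rewrite -addrA -opprD sub0r (le_trans _ (ler0n _ _)) //
    oppr_le0 addr_ge0.
have [|] := boolP (nice_copy H G f); first by move=> _ /=; lra.
rewrite negb_and => /orP[]; rewrite negb_forall => /existsP[x];
  rewrite negb_forall => /existsP[y].
  (* As [E] is contained in [G], the mismatch can only be a non-edge of [H] mapped to an edge of
     [G]. *)
  have [xy|xy] := boolP (adj H x y).
    have : [set f x; f y] \in E by rewrite mem_image_edges.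
    by move=> /(subsetP EG) xyG; rewrite /adj xyG.
  rewrite eq_sym eqbF_neg negbK => fxy.
  have xDy : x != y by apply: contraTneq fxy => ->;
    apply/negP => /adj_neq; rewrite eqxx.
  suff : 1 <= S1 by move=> /=; lra.
  rewrite /S1 (bigD1 x) //= (bigD1 y) /= ?xDy //.
  rewrite subUset sub1set -/(adj G _ _) fxy EG /= -[leLHS]addr0 -addrA lerD2l.
  by rewrite addr_ge0 //; [|apply: sumr_ge0 => ? _];
    apply: sumr_ge0 => ? _; rewrite ler0n.
rewrite negb_forall => /existsP[w]; rewrite 2!negb_imply negbK =>
  /and3P[xDy wf /andP[xw yw]].
suff : 1 <= S2 by move=> /=; lra.
rewrite /S2 (bigD1 x) //= (bigD1 y) //= (bigD1 w) //=.
rewrite !subUset !sub1set -!/(adj G _ _) xw yw EG /= -[leLHS]addr0 -!addrA lerD2l.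
by do 2?rewrite addr_ge0 //; do ?(apply: sumr_ge0 => ? _); rewrite ler0n.
Qed.

Lemma mulr_sum_exchange (R : pzRingType) (T I : finType) (P : pred I)
    (w : T -> R) (X : T -> I -> R) :
  \sum_t w t * (\sum_(i | P i) X t i) = \sum_(i | P i) \sum_t w t * X t i.
Proof. by under eq_bigr do rewrite mulr_sumr; rewrite exchange_big. Qed.

Lemma ler_sum_card (R : numDomainType) (I : finType) (P : pred I) (F : I -> R)
    (c : R) :
  0 <= c -> (forall i, P i -> F i <= c) -> \sum_(i | P i) F i <= #|I|%:R * c.
Proof.
move=> c0 Fc; rewrite mulr_natl -sumr_const big_mkcond /=.
by apply: ler_sum => i _; case: ifP => // /Fc.
Qed.

Lemma nice_copy_prob_ge (R : realType) (V W : finType) (p : R) (H : sgraph V)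
    (f : V -> W) :
  injective f -> 0 <= p <= 1 ->
  p ^+ #|edges H| * (1 - (#|V|%:R ^+ 2 * p + #|V|%:R ^+ 2 * #|W|%:R * p ^+ 2))
    <= \sum_(G : sgraph W) gnp_mass p G * (nice_copy H G f)%:R.
Proof.
move=> fI p01; have p0 : 0 <= p by case/andP: p01.
apply: le_trans (ler_sum _ (fun G _ => ler_wpM2l (gnp_mass_ge0 _ _ _ G p01)
  (nice_copy_ge R V W H G f fI))).
under eq_bigr do rewrite !mulrBr; rewrite !sumrB.
have EV := image_edges_vpairs _ _ f H fI.
rewrite gnp_mass_superset // card_image_edges //.
rewrite 2!mulr_sum_exchange.
have le1 : \sum_x \sum_G gnp_mass p G *
    (\sum_(y | (x != y) && ~~ adj H x y)
       ([set f x; f y] |: image_edges f H \subset edges G)%:R) <=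
    #|V|%:R * (#|V|%:R * p ^+ #|edges H|.+1).
  apply: ler_sum_card => [|x _]; first by rewrite ?(exprn_ge0, ler0n, mulr_ge0).
  rewrite mulr_sum_exchange; apply: ler_sum_card => [|y /andP[xy nxy]].
    by rewrite exprn_ge0.
  rewrite gnp_mass_superset; last first.
    by rewrite subUset EV sub1set inE cards2 (inj_eq fI) xy.
  (* A pair not adjacent in [H] adds a new edge, hence one more factor [p]. *)
  by rewrite cardsU1 mem_image_edges // nxy card_image_edges.
have le2 : \sum_x \sum_G gnp_mass p G *
    (\sum_(y | x != y) \sum_(w | w \notin f @: V)
       ([set f x; w] |: ([set f y; w] |: image_edges f H) \subset edges G)%:R) <=
    #|V|%:R * (#|V|%:R * (#|W|%:R * p ^+ #|edges H|.+2)).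
  apply: ler_sum_card => [|x _]; first by rewrite ?(exprn_ge0, ler0n, mulr_ge0).
  rewrite mulr_sum_exchange; apply: ler_sum_card => [|y xy].
    by rewrite mulr_ge0 ?exprn_ge0.
  rewrite mulr_sum_exchange; apply: ler_sum_card => [|w wf].
    by rewrite exprn_ge0.
  (* Since [w] is outside the image, the two pairs through [w] are new and distinct, hence a factor
     [p ^+ 2]. *)
  have fw z : f z != w by apply: contraNneq wf => <-; rewrite imset_f.
  have wE z : [set f z; w] \notin image_edges f H.
    apply: contra wf => /imsetP[e _ /setP/(_ w)].
    by rewrite !inE eqxx orbT => /esym /imsetP[v _ ->]; rewrite imset_f.
  rewrite gnp_mass_superset; last first.
    by rewrite !subUset EV !sub1set !inE !cards2 !fw.
  rewrite !cardsU1 wE card_image_edges // !inE (negbTE (wE x)) orbF.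
  suff -> : [set f x; w] != [set f y; w] by [].
  apply/eqP => /setP/(_ (f x)); rewrite !inE eqxx (inj_eq fI) (negbTE xy).
  by rewrite (negbTE (fw x)).
move: le1 le2; rewrite !exprS; set q := p ^+ #|_|; nra.
Qed.

(** * The second moment *)

(** With [c] common edges the union has [2 m - c] edges. As [c <= alpha u / 2] for [u] common
    vertices and [p <= 1], the factor [p^(-c)] is at most [p^(-alpha u / 2)]. *)
Lemma common_edges_weight (R : realType) (V W : finType) (p : R) (f g : V -> W)
    (H : sgraph V) :
  0 < p <= 1 -> balanced H -> injective f -> injective g ->
  p ^+ #|image_edges f H :|: image_edges g H| <=
  p ^+ (2 * #|edges H|) *
    (p `^ (- (ratr (avg_degree H) / 2))) ^+ #|[set x | g x \in f @: V]|.
Proof.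
move=> /andP[p0 p1] balH fI gI; have p0' := ltW p0.
have := card_common_edges R _ _ f g H balH gI.
set c := #|_ :&: _|; set u := #|[set x | _]|; set al := ratr _ => cu.
have -> : (2 * #|edges H| = #|image_edges f H :|: image_edges g H| + c)%N.
  by rewrite cardsUI !card_image_edges // mul2n addnn.
rewrite exprD -mulrA ler_peMr ?exprn_ge0 //.
rewrite -!powR_mulrn ?powR_ge0 // -powRrM -powRD; last first.
  by rewrite (gt_eqF p0) implybT.
rewrite -[leLHS](powRr0 p); apply: ger_powR; first by rewrite p0.
by move: cu; lra.
Qed.

Lemma nice_copies_second_moment (R : realType) (V : finType) (n : nat) (p : R)
    (H : sgraph V) (f : V -> 'I_n)
    (X := fun G : sgraph 'I_n =>
            \sum_(s : 'S_n) (nice_copy H G (s \o f))%:R : R) :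
  injective f -> 0 < p <= 1 -> 0 <= avg_degree H -> balanced H ->
  \sum_G gnp_mass p G * X G ^+ 2 <=
  (n`!%:R * p ^+ #|edges H|) ^+ 2 *
   (1 + (p `^ (- (ratr (avg_degree H) / 2)) - 1) * (#|V|%:R / n%:R)) ^+ #|V|.
Proof.
move=> fI p01 al0 balH; have /andP[p0 p1] := p01; have p0' := ltW p0.
have p01' : 0 <= p <= 1 by rewrite ltW.
set a := p `^ _.
have a1 : 1 <= a.
  rewrite /a -[leLHS](powRr0 p); apply: ger_powR; first by rewrite p0.
  by rewrite oppr_le0 divr_ge0 // ler0q.
have sI (s : 'S_n) : injective (s \o f) by exact: inj_comp perm_inj fI.
have niceE G (s : 'S_n) : (nice_copy H G (s \o f))%:R <=
    (image_edges (s \o f) H \subset edges G)%:R :> R.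
  rewrite ler_nat; case: (boolP (nice_copy _ _ _)) => //
    /andP[/'forall_forallP fadj _].
  rewrite lt0b; apply/subsetP => _ /imsetP[e eH ->].
  have /eqP/cards2P[x [y [_ exy]]] := edge_card _ _ _ eH.
  move: eH; rewrite exy -/(adj H x y) (eqP (fadj x y)) /adj.
  by rewrite imsetU1 imset_set1.
have X2 G : X G ^+ 2 <= \sum_(s : 'S_n) \sum_(t : 'S_n)
    (image_edges (s \o f) H :|: image_edges (t \o f) H \subset edges G)%:R.
  rewrite expr2 mulr_suml; apply: ler_sum => s _.
  rewrite mulr_sumr; apply: ler_sum => t _.
  apply: le_trans (ler_pM _ _ (niceE G s) (niceE G t)) _ => //.
  by rewrite subUset -natrM mulnb.
apply: le_trans (ler_sum _ (fun G _ => ler_wpM2l (gnp_mass_ge0 _ _ _ G p01')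
  (X2 G))) _.
rewrite mulr_sum_exchange.
(* The bound on the inner sum is the same for every [s], so the outer sum only costs a factor
   [n!]. *)
have -> : n`!%:R = #|{perm 'I_n}|%:R :> R by rewrite card_Sn.
rewrite exprMn expr2 -!mulrA; apply: ler_sum_card => [|s _].
  by rewrite !mulr_ge0 ?exprn_ge0 // addr_ge0 // mulr_ge0 ?divr_ge0 // subr_ge0.
rewrite mulr_sum_exchange.
(* The power of [a] splits over the vertices of [f @: V]: a factor [a] if [t] sends [x] into the
   copy given by [s], and 1 otherwise. *)
apply: (@le_trans _ _ (\sum_(t : 'S_n) p ^+ (2 * #|edges H|) *
   \prod_(x in f @: V) (1 + (a - 1) * (t x \in (s \o f) @: V)%:R))).
  apply: ler_sum => t _; rewrite gnp_mass_superset; last first.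
    by rewrite subUset !image_edges_vpairs.
  apply: le_trans (common_edges_weight _ _ _ _ _ _ _ p01 balH (sI s) (sI t)) _.
  rewrite ler_wpM2l ?exprn_ge0 //.
  rewrite big_imset /=; last by move=> x y _ _; exact: fI.
  rewrite -prodr_const big_mkcond /= le_eqVlt; apply/orP; left; apply/eqP.
  apply: eq_bigr => x _; rewrite inE /=.
  by case: (_ \in _); rewrite ?mulr1 ?mulr0 ?addr0 // addrC subrK.
rewrite -mulr_sumr exprM exprAC expr2 -mulrA.
do 2?[rewrite [leRHS]mulrCA ler_wpM2l ?exprn_ge0 //].
have := @sum_perm_prod_le R n (a - 1) ((s \o f) @: V) (f @: V).
by rewrite subr_ge0 card_Sn !card_imset // => /(_ a1).
Qed.

(** * Numerical estimates *)

(** Combines [1 + e / k <= exp (e / k)] with [1 - e <= exp (- e)]; for [e >= 1] the left side is not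
    positive. *)
Lemma expr_1Ddiv_le (R : realType) (e : R) (k : nat) :
  0 <= e -> (1 - e) * (1 + e / k%:R) ^+ k <= 1.
Proof.
move=> e0; have [->|k0] := eqVneq k 0%N; first by rewrite expr0; lra.
have k1 : k%:R != 0 :> R by rewrite pnatr_eq0.
have le_exp : (1 + e / k%:R) ^+ k <= expR e.
  rewrite -[e in leRHS](divfK k1) expRM_natr lerXn2r ?nnegrE ?expR_ge0
    ?expR_ge1Dx //.
  by rewrite addr_ge0 // divr_ge0.
have [e1|/ltW e1] := leP 1 e.
  by rewrite (le_trans _ ler01) // mulr_le0_ge0 ?subr_le0 //
    exprn_ge0 // addr_ge0 // divr_ge0.
rewrite -[leRHS](expRxMexpNx_1 e) mulrC ler_pM ?subr_ge0 //; last exact: expR_ge1Dx.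
by rewrite exprn_ge0 // addr_ge0 // divr_ge0.
Qed.

(** The second hypothesis makes [d] large, then the first makes [n] large, so that replacing [n - 1]
    by [n] costs little. *)
Lemma parameter_bounds (R : realType) (n k : nat) (d eps alpha : R)
    (p := d / (n%:R - 1)) :
  (1 < n)%N -> (0 < k)%N -> 0 < d -> 0 < eps <= 1 / 7 -> 3 < alpha < 4 ->
  k%:R ^+ 2 * d ^+ 2 / n%:R <= eps ->
  k%:R ^+ 4 * n%:R `^ (alpha - 2) / d `^ alpha <= eps ^+ 2 ->
  [/\ 0 < p <= 1, (k <= n)%N,
      2 * (k%:R ^+ 2 * p + k%:R ^+ 2 * n%:R * p ^+ 2) <= 3 * eps &
      p `^ (- (alpha / 2)) * (k%:R ^+ 2 / n%:R) <= eps].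
Proof.
move=> n1 k0 d0 /andP[e0 e7] /andP[al3 al4] h1 h2.
have nr1 : 1 < n%:R :> R by rewrite ltr1n.
have nr0 : 0 < n%:R :> R by lra.
have kr1 : 1 <= k%:R :> R by rewrite ler1n.
have k2 : 1 <= k%:R ^+ 2 :> R by rewrite exprn_ege1.
have k4 : 1 <= k%:R ^+ 4 :> R by rewrite exprn_ege1.
have da0 : 0 < d `^ alpha by rewrite powR_gt0.
(* The numerator in the second hypothesis is at least 1, so [d^alpha >= 1 / eps^2]. *)
have dal : 49 <= d `^ alpha.
  have n2 : 1 <= n%:R `^ (alpha - 2).
    by rewrite -[leLHS](powRr0 n%:R) ler_powR //; lra.
  have : 1 <= k%:R ^+ 4 * n%:R `^ (alpha - 2) by rewrite mulr_ege1.
  move: h2; rewrite ler_pdivrMr //.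
  have : eps ^+ 2 <= 1 / 49 by nra.
  nra.
have d0' := ltW d0; have e0' := ltW e0; have nr0' := ltW nr0.
have d1 : 1 <= d.
  rewrite leNgt; apply/negP => d1.
  have : d `^ alpha <= 1.
    by rewrite -[leRHS](powRr0 d) ger_powR ?d0 //=; lra.
  lra.
have d4 : 49 <= d ^+ 4.
  by apply: le_trans dal _; rewrite -powR_mulrn ?(ltW d0) // ler_powR // ltW.
have d7 : 7 <= d ^+ 2 by nra.
have d52 : 5 / 2 <= d by nra.
have kdn : k%:R ^+ 2 * d ^+ 2 <= eps * n%:R by rewrite -ler_pdivrMr.
have kd2 : k%:R ^+ 2 <= k%:R ^+ 2 * d ^+ 2 :> R by nra.
have dd2 : d ^+ 2 <= k%:R ^+ 2 * d ^+ 2 :> R by nra.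
have n49 : 49 <= n%:R :> R by nra.
have nm : 0 < n%:R - 1 :> R by lra.
have p0 : 0 < p by rewrite divr_gt0.
have nm' := ltW nm; have p0' := ltW p0.
split.
- by rewrite p0 ler_pdivrMr // mul1r; nra.
- by rewrite -(ler_nat R); nra.
(* From [d >= 5 / 2] comes [d <= (2 / 5) d^2]; the constant 3 then works because
   [2 ((2 / 5) r + r^2) <= 3] for [r <= 49 / 48]. *)
- pose r : R := n%:R / (n%:R - 1).
  have r49 : r <= 49 / 48 by rewrite ler_pdivrMr //; lra.
  have r0 : 0 <= r by rewrite divr_ge0 //.
  have A1 : k%:R ^+ 2 * p <= 2 / 5 * eps * r.
    rewrite /p /r !mulrA ler_wpM2r ?invr_ge0 //; nra.
  have A2 : k%:R ^+ 2 * n%:R * p ^+ 2 <= eps * r ^+ 2.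
    rewrite /p /r !expr_div_n !mulrA ler_wpM2r ?invr_ge0 ?exprn_ge0 //.
    by have := ler_wpM2r nr0' kdn; lra.
  have : r ^+ 2 <= (49 / 48) ^+ 2 by nra.
  nra.
- have a0 := powR_ge0 p (- (alpha / 2)).
  (* After squaring, [p >= d / n] reduces the claim to the second hypothesis. *)
  rewrite -ler_sqr ?nnegrE ?mulr_ge0 ?invr_ge0 ?sqr_ge0 //.
  apply: le_trans h2; rewrite exprMn -[X in X * _]powR_mulrn // -powRrM.
  have -> : - (alpha / 2) * 2%:R = - alpha by field.
  have pa : (d / n%:R) `^ alpha <= p `^ alpha.
    apply: ge0_ler_powR; rewrite ?nnegrE ?divr_ge0 //; try lra.
    by rewrite /p ler_pM2l // lef_pV2 ?posrE //; lra.
  have dn0 : 0 < (d / n%:R) `^ alpha by rewrite powR_gt0 // divr_gt0.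
  have na0 : 0 < n%:R `^ alpha :> R by rewrite powR_gt0.
  have dnE : (d / n%:R) `^ alpha * n%:R `^ alpha = d `^ alpha.
    by rewrite -powRM ?divfK ?gt_eqF // ?divr_ge0 //.
  have -> : n%:R `^ (alpha - 2) = n%:R `^ alpha / n%:R ^+ 2.
    by rewrite powRB ?(gt_eqF nr0) ?implybT // -powR_mulrn //.
  rewrite powRN.
  have -> : k%:R ^+ 4 * (n%:R `^ alpha / n%:R ^+ 2) / d `^ alpha =
     ((d / n%:R) `^ alpha)^-1 * (k%:R ^+ 2 / n%:R) ^+ 2.
    by rewrite -dnE; field; rewrite !gt_eqF.
  by rewrite ler_wpM2r ?sqr_ge0 // lef_pV2 ?posrE // (lt_le_trans dn0).
Qed.

(** * Choice of the multiplier and conclusion *)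

Theorem theorem55 (R : realType) (n k : nat) (d eps alpha : R)
    (V : finType) (H : sgraph V) :
  (1 < n)%N -> 0 < d ->
  0 < eps <= 1 / 7 ->
  3 < alpha < 4 ->
  k%:R ^+ 2 * d ^+ 2 / n%:R <= eps ->
  k%:R ^+ 4 * n%:R `^ (alpha - 2) / d `^ alpha <= eps ^+ 2 ->
  #|V| = k ->
  balanced H ->
  ratr (avg_degree H) = alpha ->
  1 - 4 * eps <=
    gnd_prob d (fun G : sgraph 'I_n =>
      exists S : {set 'I_n},
        [/\ #|S| = k,
            isomorphic (induced G S) H &
            no_common_neighbor_outside G S]).
Proof.
move=> n1 d0 eps01 al34 h1 h2 Vk balH Hal.
(* Division by zero gives an empty graph average degree 0, against [alpha > 3]. *)
have k0 : (0 < k)%N.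
  rewrite lt0n; apply/eqP => k0; move: al34.
  rewrite -Hal /avg_degree Vk k0 invr0 mulr0 rmorph0; lra.
have := parameter_bounds R n k d eps alpha n1 k0 d0 eps01 al34 h1 h2.
rewrite /gnd_prob; set p := d / _ => -[p01 kn delta_le a_le].
have /andP[p0 p1] := p01; have /andP[e0 e7] := eps01.
have p01' : 0 <= p <= 1 by rewrite (ltW p0).
pose f (x : V) : 'I_n := widen_ord kn (cast_ord Vk (enum_rank x)).
have fI : injective f.
  by move=> x y /(congr1 val)/= /val_inj /enum_rank_inj.
pose X (G : sgraph 'I_n) : R := \sum_(s : 'S_n) (nice_copy H G (s \o f))%:R.
pose N : R := n`!%:R * p ^+ #|edges H|.
have N0 : 0 < N by rewrite mulr_gt0 ?exprn_gt0 // ltr0n fact_gt0.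
set a := p `^ _ in a_le.
pose x := k%:R ^+ 2 * p + k%:R ^+ 2 * n%:R * p ^+ 2.
pose B := (1 + (a - 1) * (k%:R / n%:R)) ^+ k.
(* The base of [B] is at most [1 + eps / k], because [a k^2 / n <= eps]. *)
have B_le : (1 - eps) * B <= 1.
  apply: le_trans (expr_1Ddiv_le R eps k (ltW e0)).
  have n0 : 0 < n%:R :> R by rewrite ltr0n; lia.
  have kr0 : 0 < k%:R :> R by rewrite ltr0n.
  have a1 : 1 <= a.
    rewrite /a -[leLHS](powRr0 p) ger_powR //; lra.
  rewrite ler_wpM2l //; first lra.
  have kn0 : 0 <= k%:R / n%:R :> R by rewrite divr_ge0.
  have ak0 : 0 <= (a - 1) * (k%:R / n%:R) by rewrite mulr_ge0 // subr_ge0.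
  have ek0 : 0 <= eps / k%:R by rewrite divr_ge0 // ltW.
  rewrite /B lerXn2r ?nnegrE ?addr_ge0 // lerD2l ler_pdivlMr //.
  apply: le_trans a_le; rewrite -mulrA mulrAC -expr2.
  by rewrite ler_wpM2r ?divr_ge0 ?exprn_ge0 //; lra.
have M1 : N * (1 - x) <= \sum_G gnp_mass p G * X G.
  rewrite mulr_sum_exchange /N -mulrA mulr_natl -card_Sn -sumr_const.
  apply: ler_sum => s _.
  have sI : injective (s \o f) by exact: inj_comp perm_inj fI.
  by have := nice_copy_prob_ge R _ _ p H _ sI p01'; rewrite card_ord Vk.
have M2 : \sum_G gnp_mass p G * X G ^+ 2 <= N ^+ 2 * B.
  have al0 : 0 <= avg_degree H.
    by rewrite -(ler0q R) Hal; lra.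
  by have := nice_copies_second_moment R V n p H f fI p01 al0 balH; rewrite Hal Vk.
(* This maximizes [2 c N - c^2 N^2 / (1 - eps)], the lower bound with [x] neglected. *)
pose c := (1 - eps) / N.
have cN : c * N = 1 - eps by rewrite divfK // gt_eqF.
have c0 : 0 <= c by rewrite divr_ge0 ?(ltW N0) //; lra.
apply: (@le_trans _ _ (\sum_(G | X G != 0) gnp_mass p G)).
  apply: le_trans (second_moment_method R _ (gnp_mass p) X c _); last first.
    by move=> G; exact: gnp_mass_ge0.
  have P1 : (1 - eps) * (1 - x) <= c * (\sum_G gnp_mass p G * X G).
    by rewrite -cN -mulrA ler_wpM2l.
  have P2 : c ^+ 2 * (\sum_G gnp_mass p G * X G ^+ 2) <= 1 - eps.
    apply: (@le_trans _ _ (c ^+ 2 * (N ^+ 2 * B))).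
      by rewrite ler_wpM2l // exprn_ge0.
    rewrite mulrA -exprMn cN expr2 -mulrA ler_piMr //; lra.
  (* Since [2 x <= 3 eps], [(1 - eps) (1 - 2 x) >= (1 - eps) (1 - 3 eps) >= 1 - 4 eps]. *)
  move: delta_le; rewrite -/x; nra.
rewrite /gnp_prob [leLHS]big_mkcond [leRHS]big_mkcond; apply: ler_sum => G _.
case: (eqVneq (X G) 0) => [_|XG0] /=.
  by case: ifP => // _; exact: gnp_mass_ge0.
rewrite asboolT //.
have /existsP[s sG] : [exists s : 'S_n, nice_copy H G (s \o f)].
  apply: contraNT XG0; rewrite negb_exists => /forallP noG.
  by rewrite /X big1 // => s _; rewrite (negbTE (noG s)).
have sI : injective (s \o f) by exact: inj_comp perm_inj fI.
have [cS isoS cnS] := nice_copyP _ _ _ _ _ sI sG.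
by exists ((s \o f) @: V); rewrite -Vk.
Qed.
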